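(* Let $n$ be an odd positive integer and $m$ a positive integer. For a random chain complex $0\leftarrow A_0\xleftarrow{d_1}A_1\xleftarrow{d_2}\cdots\xleftarrow{d_n}A_n\leftarrow 0$ with $A_i=\mathbb R^{m}$ for every $i=0,\dots,n$, almost surely $\beta_i=0$ for all $i=0,1,\dots,n$.
   Context: Model of a random chain complex: fix nonnegative integers $\vec a=(a_0,\dots,a_n)$ and $A_i=\mathbb R^{a_i}$. A sequence of linear maps $d_i:A_i\to A_{i-1}$ ($i=1,\dots,n$) is a point of $\mathbb R^N$, $N=\sum_{i=1}^n a_{i-1}a_i$. Let $M(\vec a)\subseteq\mathbb R^N$ be the real affine algebraic variety of chain complexes ($d_i\circ d_{i+1}=0$ for all $i$); let $k$ be its Hausdorff dimension. Fix a bounded measurable probability density $f$ on $\mathbb R^N$ (e.g.\ standard Gaussian) with $\int_{M(\vec a)} f\,d\mathcal H^k>0$. For a subvariety $Y\subseteq M(\vec a)$ define $\Pr(Y)=\int_Y f\,d\mathcal H^k/\int_{M(\vec a)} f\,d\mathcal H^k$, $\mathcal H^k$ the $k$-dimensional Hausdorff measure. A random chain complex is a point of $M(\vec a)$ under this measure; ''almost surely'' means with probability $1$. Betti numbers: with $r_i=\operatorname{rank} d_i$ and $r_0=r_{n+1}=0$, $\beta_i=a_i-r_i-r_{i+1}$. *)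

(* Defs.v *)
From HB Require Import structures.
From mathcomp Require Import all_boot all_order all_algebra.
From mathcomp Require Import all_classical all_reals all_analysis.
Set Implicit Arguments. Unset Strict Implicit. Unset Printing Implicit Defensive.
Import Order.TTheory GRing.Theory Num.Theory.
Local Open Scope classical_set_scope.
Local Open Scope ring_scope.

Definition coordspace (C : finType) (R : realType) : Type := {ffun C -> R}.
HB.instance Definition _ C R := Choice.on (coordspace C R).
HB.instance Definition _ C R :=
  isPointed.Build (coordspace C R) [ffun=> (0%R : R)].

Definition euclid_dist {C : finType} {R : realType} (x y : coordspace C R) : R :=
  Num.sqrt (\sum_(c : C) (x c - y c) ^+ 2).

Definition eopen {C : finType} {R : realType} (A : set (coordspace C R)) :=
  forall x, A x -> exists2 e : R, 0 < e & [set y | euclid_dist x y < e] `<=` A.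

Definition borel_fun {C : finType} {R : realType} (f : coordspace C R -> R) :=
  forall B : set R, measurable B -> <<s (@eopen C R) >> (f @^-1` B).

(* Auxiliary: every set is "measurable" in [discr T]; this is only    *)
(* used to feed arbitrary covers to the library's [mu_ext]            *)
(* (inf over countable covers of the sum of the weights).             *)
Definition discr (T : Type) : Type := T.
HB.instance Definition _ (T : pointedType) := Pointed.on (discr T).
HB.instance Definition _ (T : pointedType) :=
  @isMeasurable.Build default_measure_display (discr T) discrete_measurable
    discrete_measurable0 discrete_measurableC discrete_measurableU.

(* Hausdorff outer measure and Hausdorff dimension of a metric space. *)
(* H^s(A) = lim_{delta -> 0} inf { sum_i diam(U_i)^s |                 *)
(*                 A <= \bigcup_i U_i, diam U_i <= delta }             *)
(* (convention 0^0 = 1 and diam(set0)^s = 0; no normalising constant) *)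
Section hausdorff.
Context {R : realType} {T : pointedType} (dist : T -> T -> R).
Local Open Scope ereal_scope.

Definition diam (A : set T) : \bar R :=
  ereal_sup [set (dist x y)%:E | x in A & y in A].

Definition hweight (s delta : R) (A : set (discr T)) : \bar R :=
  if `[< A = set0 >] then 0
  else if diam A <= delta%:E then ((fine (diam A)) `^ s)%:E else +oo.

Lemma hweight0 s delta : hweight s delta set0 = 0.
Proof. by rewrite /hweight asboolT. Qed.

Lemma hweight_ge0 s delta A : 0 <= hweight s delta A.
Proof.
rewrite /hweight; case: ifP => // _; case: ifP => // _.
by rewrite lee_fin powR_ge0.
Qed.

Definition hcontent (s delta : R) (A : set T) : \bar R :=
  mu_ext (hweight s delta) A.

Definition hmeasure (s : R) (A : set T) : \bar R :=
  ereal_sup [set hcontent s delta A | delta in [set delta : R | (0 < delta)%R]].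

Lemma hcontent_ge0 s delta A : 0 <= hcontent s delta A.
Proof. rewrite /hcontent; exact: (mu_ext_ge0 (@hweight_ge0 s delta)). Qed.

Lemma hcontent0 s delta : hcontent s delta set0 = 0.
Proof. rewrite /hcontent; exact: (mu_ext0 (hweight0 s delta) (@hweight_ge0 s delta)). Qed.

Lemma hcontent_le_hmeasure s delta A : (0 < delta)%R ->
  hcontent s delta A <= hmeasure s A.
Proof. by move=> d0; apply: ereal_sup_ubound; exists delta. Qed.

Lemma hmeasure0 s : hmeasure s set0 = 0.
Proof.
apply/eqP; rewrite eq_le; apply/andP; split.
  by apply: ub_ereal_sup => _ [delta _ <-]; rewrite hcontent0.
by rewrite -(hcontent0 s 1) hcontent_le_hmeasure.
Qed.

Lemma hmeasure_ge0 s A : 0 <= hmeasure s A.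
Proof.
exact: le_trans (hcontent_ge0 s 1 A) (hcontent_le_hmeasure _ _ ltr01).
Qed.

Lemma le_hmeasure s : {homo hmeasure s : A B / A `<=` B >-> A <= B}.
Proof.
move=> A B AB; apply: ub_ereal_sup => _ [delta d0 <-].
apply: le_trans (hcontent_le_hmeasure _ _ d0).
exact: (le_mu_ext (hweight s delta)).
Qed.

Lemma hmeasure_sigma_subadditive s : sigma_subadditive (hmeasure s).
Proof.
move=> F; apply: ub_ereal_sup => _ [delta d0 <-].
apply: le_trans (mu_ext_sigma_subadditive (@hweight_ge0 s delta) F) _.
apply: lee_nneseries => [i _ _|i _]; first exact: hcontent_ge0.
exact: hcontent_le_hmeasure.
Qed.

HB.instance Definition _ (s : R) := isOuterMeasure.Build R T (hmeasure s)
  (hmeasure0 s) (hmeasure_ge0 s) (@le_hmeasure s)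
  (hmeasure_sigma_subadditive s).

Definition hdim (A : set T) : \bar R :=
  ereal_inf [set s%:E | s in [set s : R | (0 <= s)%R /\ hmeasure s A = 0]].

End hausdorff.

Section lebesgue.
Context {C : finType} {R : realType}.
Local Open Scope ereal_scope.

Definition box (a b : C -> R) : set (coordspace C R) :=
  [set x | forall c, (a c <= x c <= b c)%R].

Definition boxweight (A : set (discr (coordspace C R))) : \bar R :=
  if `[< A = set0 >] then 0
  else ereal_inf [set r | exists a b : C -> R,
     [/\ (forall c, a c <= b c)%R, A = box a b & r = (\prod_c (b c - a c))%:E]].

Lemma boxweight0 : boxweight set0 = 0.
Proof. by rewrite /boxweight asboolT. Qed.

Lemma boxweight_ge0 A : 0 <= boxweight A.
Proof.
rewrite /boxweight; case: ifP => // _.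
apply/ereal_infP => _ [a [b [ab _ ->]]].
by rewrite lee_fin; apply: prodr_ge0 => c _; rewrite subr_ge0.
Qed.

Definition lebesgue_outer (A : set (coordspace C R)) : \bar R :=
  mu_ext boxweight A.

HB.instance Definition _ := isOuterMeasure.Build R (coordspace C R)
  lebesgue_outer (mu_ext0 boxweight0 boxweight_ge0)
  (@mu_ext_ge0 _ _ _ _ boxweight_ge0) (@le_mu_ext _ _ _ boxweight)
  (mu_ext_sigma_subadditive boxweight_ge0).

End lebesgue.

Definition hausdorff_integral {C : finType} {R : realType} (s : R)
    (Y : set (coordspace C R)) (g : coordspace C R -> R) : \bar R :=
  (\int[(hmeasure (@euclid_dist C R) s :
          set (caratheodory_type (hmeasure (@euclid_dist C R) s)) -> \bar R)]_(x in Y)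
     (g x)%:E)%E.

Definition lebesgue_integral {C : finType} {R : realType}
    (g : coordspace C R -> R) : \bar R :=
  (\int[(@lebesgue_outer C R :
          set (caratheodory_type (@lebesgue_outer C R)) -> \bar R)]_x
     (g x)%:E)%E.

(* Random chain complexes with A_0 = ... = A_n = R^m.                 *)
(* A point x of R^N, N = n * m * m, coordinates indexed by            *)
(* 'I_n * 'I_m * 'I_m, encodes the maps d_1, ..., d_n : the matrix    *)
(* [cmap x i] (i : 'I_n) is d_{i+1} : A_{i+1} -> A_i (acting on       *)
(* column vectors).                                                    *)
Definition cindex (n m : nat) : finType := ('I_n * 'I_m * 'I_m)%type.

Definition cspace (R : realType) (n m : nat) : Type :=
  coordspace (cindex n m) R.

Definition cmap {R : realType} {n m : nat} (x : cspace R n m) (i : 'I_n) :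
  'M[R]_m := \matrix_(j < m, l < m) x (i, j, l).

Definition chain_complexes (R : realType) (n m : nat) : set (cspace R n m) :=
  [set x | forall i j : 'I_n, j = i.+1 :> nat -> cmap x i *m cmap x j = 0].
Arguments chain_complexes : clear implicits.

Definition crank {R : realType} {n m : nat} (x : cspace R n m) (i : nat) : nat :=
  if i is i'.+1 then
    (if (insub i' : option 'I_n) is Some j then \rank (cmap x j) else 0)%N
  else 0%N.

Definition betti {R : realType} {n m : nat} (x : cspace R n m) (i : nat) : int :=
  (m%:Z - (crank x i)%:Z - (crank x i.+1)%:Z)%R.

Definition chain_prob {R : realType} {n m : nat} (k : R) (f : cspace R n m -> R)
    (Y : set (cspace R n m)) : R :=
  (fine (@hausdorff_integral (cindex n m) R k Y f) /
   fine (@hausdorff_integral (cindex n m) R k (chain_complexes R n m) f))%R.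

(* Main.v *)
(** Write r_i = rank d_i.  A stratum of complexes with prescribed ranks is, by
    induction on i, locally a Lipschitz graph over #|S| of its matrix entries:
    d_i d_(i+1) = 0 expresses the rows of d_(i+1) indexed by the pivot columns
    of d_i through the others, and a matrix of rank r is determined by r pivot
    rows and r pivot columns.  Counting entries and telescoping,
    2 #|S| = (n+1) m^2 - sum_i beta_i^2.  Hence every stratum with a non-zero
    Betti number is H^k-null as soon as k >= d = (n+1) m^2 / 2.  Conversely
    k >= d because the complexes contain a coordinate subspace of dimension d:
    only the maps d_1, d_3, ..., d_n are non-zero there.  That a d-dimensional
    cube has positive H^s for s < d follows from the fact that countably many
    boxes covering it have total volume at least 1, proved by integrating out
    one coordinate at a time. *)
Require Import Defs.
From mathcomp Require Import all_boot all_order all_algebra.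
From mathcomp Require Import all_classical all_reals all_analysis.
From mathcomp Require Import measurable_realfun ring lra zify.
Import Order.TTheory GRing.Theory Num.Theory.
Local Open Scope classical_set_scope.
Local Open Scope ring_scope.

(** * Integrals over two sets that differ by a null set *)

Section NegligibleDifference.
Local Open Scope ereal_scope.
Import HBNNSimple.

(** [g] is an arbitrary non-negative function, so the comparison is made on the suprema over simple
    functions that define the two integrals. *)
Lemma ge0_integral_negligible_setD d (T : measurableType d) (R : realType)
    (mu : {measure set T -> \bar R}) (M Y : set T) (g : T -> \bar R) :
  (forall x, 0 <= g x) -> Y `<=` M -> measurable (M `\` Y) ->
  mu (M `\` Y) = 0 ->
  \int[mu]_(x in Y) g x = \int[mu]_(x in M) g x.
Proof.
move=> g0 YM mN N0.
rewrite !ge0_integralE//; apply/eqP; rewrite eq_le; apply/andP; split.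
  apply: ge_ereal_sup => _ [h /= hg <-]; apply: ereal_sup_ubound.
  exists h => //= x; apply: le_trans (hg x) _; rewrite !patchE.
  have [xY|_] := boolP (x \in Y); last by case: ifP.
  by rewrite ifT// inE; apply: YM; rewrite inE in xY.
apply: ge_ereal_sup => _ [h /= hg <-]; apply: ereal_sup_ubound.
(* A simple function below [g] on [M] is cut off to zero on [M \ Y]. It then lies below [g] on [Y],
   and its integral is unchanged. *)
have mC : measurable (~` (M `\` Y)) by exact: measurableC.
exists (mul_nnsfun h (indic_nnsfun R mC)) => /=.
  move=> x; change ((h x * \1_(~` (M `\` Y)) x)%:E <= (g \_ Y) x).
  have := hg x; rewrite !patchE indicE.
  have [xY|xY] := boolP (x \in Y).
    rewrite ifT; last by rewrite inE; apply: YM; rewrite inE in xY.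
    apply: le_trans; rewrite lee_fin.
    by case: (_ \in _); rewrite ?mulr1 ?mulr0// fun_ge0.
  have [xM|xM] := boolP (x \in M); first rewrite memNset ?mulr0//=.
    by apply; split; [rewrite inE in xM|rewrite notin_setE in xY].
  by case: (_ \in _); rewrite ?mulr1 ?mulr0.
rewrite -!integralT_nnsfun; apply: ge0_ae_eq_integral => //=.
- by apply/measurable_EFinP; apply: measurable_funM.
- by apply/measurable_EFinP.
- by move=> x _; rewrite lee_fin mulr_ge0.
- by move=> x _; rewrite lee_fin.
exists (M `\` Y); split => // x /= /not_implyP[_] H; apply: contrapT => Nx.
by apply: H; change ((h x * \1_(~` (M `\` Y)) x)%:E = (h x)%:E); rewrite indicE mem_set ?mulr1.
Qed.

End NegligibleDifference.

(** A set of outer measure zero is Caratheodory measurable, since its trace on any set is null;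
    hence the difference needs no separate measurability proof. *)
Lemma integral_caratheodory_negligible (T : pointedType) (R : realType)
    (mu : {outer_measure set T -> \bar R})
    (M Y : set T) (g : T -> R) :
  (forall x, 0 <= g x) -> Y `<=` M -> mu (M `\` Y) = 0%E ->
  (\int[(mu : set (caratheodory_type mu) -> \bar R)]_(x in Y) (g x)%:E =
   \int[(mu : set (caratheodory_type mu) -> \bar R)]_(x in M) (g x)%:E)%E.
Proof.
move=> g0 YM N0.
apply: (@ge0_integral_negligible_setD _ (caratheodory_type mu) R
  (mu : set (caratheodory_type mu) -> \bar R) M Y (fun x => (g x)%:E)) => //.
apply: le_caratheodory_measurable => X.
have -> : mu (X `&` (M `\` Y)) = 0%E.
  apply/eqP; rewrite eq_le outer_measure_ge0 andbT -N0.
  by apply: le_outer_measure; exact: subIsetr.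
by rewrite add0e; apply: le_outer_measure; exact: subIsetl.
Qed.
Lemma hausdorff_integral_negligible (C : finType) (R : realType) (s : R)
    (M Y : set (coordspace C R)) (g : coordspace C R -> R) :
  (forall x, 0 <= g x) -> Y `<=` M ->
  hmeasure (@euclid_dist C R) s (M `\` Y) = 0%E ->
  hausdorff_integral s Y g = hausdorff_integral s M g.
Proof.
exact: (@integral_caratheodory_negligible (coordspace C R) R (hmeasure (@euclid_dist C R) s)).
Qed.

(** * Volume of box covers of the unit cube *)

Section BoxCover.
Local Open Scope ereal_scope.

(* The weights w carry the side lengths of the coordinates already integrated
   out. *)
Lemma box_cover_volume (R : realType) (d : nat) (w : nat -> R)
    (a b : nat -> nat -> R) :
  (forall i, 0 <= w i)%R -> (forall i j, a i j <= b i j)%R ->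
  (forall x : nat -> R, (forall j, 0 <= x j <= 1)%R ->
    1 <= \sum_(i <oo) (w i * \prod_(j < d) \1_(`[a i j, b i j]%classic) (x j))%:E) ->
  1 <= \sum_(i <oo) (w i * \prod_(j < d) (b i j - a i j))%:E.
Proof.
elim: d w => [|d IHd] w w0 ab cov.
  have E (F : nat -> 'I_0 -> R) :
      \sum_(i <oo) (w i * \prod_(j < 0) F i j)%:E = \sum_(i <oo) (w i)%:E.
    by apply: eq_eseriesr => i _; rewrite big_ord0 mulr1.
  have := cov (fun=> 0%R); rewrite !E; apply => j.
  by rewrite lexx ler01.
have wab i : (0 <= w i * (b i d - a i d))%R by rewrite mulr_ge0 ?subr_ge0.
(* The side of the last coordinate moves into the weight. *)
rewrite (eq_eseriesr
  (g := fun i => ((w i * (b i d - a i d)) * \prod_(j < d) (b i j - a i j))%:E)); last first.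
  by move=> i _; rewrite big_ord_recr/= mulrAC mulrA.
apply: IHd => // x x01.
pose P i : R := (\prod_(j < d) \1_(`[a i j, b i j]%classic) (x j))%R.
have P0 i : (0 <= P i)%R by apply: prodr_ge0 => j _; rewrite indicE.
have covt t : (0 <= t <= 1)%R ->
    1 <= \sum_(i <oo) (w i * P i)%:E * (\1_(`[a i d, b i d]%classic) t)%:E.
  move=> t01; have := cov (fun j => if j == d then t else x j).
  rewrite (eq_eseriesr
    (g := fun i => (w i * P i)%:E * (\1_(`[a i d, b i d]%classic) t)%:E)); last first.
    move=> i _; rewrite big_ord_recr/= eqxx -EFinM mulrA; congr (_ * _ * _)%:E.
    by apply: eq_bigr => j _; rewrite ltn_eqF.
  by apply=> j; case: ifP.
pose I01 : set R := `[0%R, 1%R]%classic.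
have mI : measurable I01 by exact: measurable_itv.
have mind i : measurable_fun I01
    (fun t : R => (w i * P i)%:E * (\1_(`[a i d, b i d]%classic) t)%:E).
  apply: emeasurable_funM; first exact: measurable_cst.
  by apply/measurable_EFinP; exact: measurable_indic.
have ge0i i (t : R) : 0 <= (w i * P i)%:E * (\1_(`[a i d, b i d]%classic) t)%:E.
  by rewrite -EFinM lee_fin mulr_ge0 ?mulr_ge0// indicE.
(* The covering inequality is integrated over the last coordinate [t] in [0, 1]; each interval meets
   [0, 1] in measure at most [b i d - a i d]. *)
have -> : 1 = \int[@lebesgue_measure R]_(t in I01) (1 : \bar R).
  by rewrite integral_cst//= mul1e lebesgue_measure_itv/= lte01 oppr0 adde0.
have le1 : \int[@lebesgue_measure R]_(t in I01) (1 : \bar R) <=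
    \int[@lebesgue_measure R]_(t in I01) \sum_(i <oo)
      (w i * P i)%:E * (\1_(`[a i d, b i d]%classic) t)%:E.
  apply: ge0_le_integral => //.
  apply: (@ge0_emeasurable_sum _ (measurableTypeR R) R I01 _ xpredT).
    by move=> i t _ _; exact: ge0i.
  by move=> i _; exact: mind.
apply: le_trans le1 _; rewrite integral_nneseries//.
apply: lee_nneseries => [i _ _|i _]; first by apply: integral_ge0.
rewrite ge0_integralZl//; last 2 first.
- by apply/measurable_EFinP; exact: measurable_indic.
- by rewrite lee_fin mulr_ge0.
rewrite integral_indic//= mulrAC [leRHS]EFinM lee_wpmul2l ?lee_fin ?mulr_ge0//.
apply: (@le_trans _ _ (lebesgue_measure `[a i d, b i d]%classic)).
  by apply: le_measure; rewrite ?inE//; exact: measurableI.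
rewrite lebesgue_measure_itv/= lte_fin; case: ifP => // _.
by rewrite lee_fin subr_ge0.
Qed.

End BoxCover.

(** * Euclidean distance against coordinatewise bounds *)

Section EuclideanDistance.
Context {C : finType} {R : realType}.
Implicit Types x y : coordspace C R.

Lemma coord_le_euclid_dist x y c : `|x c - y c| <= euclid_dist x y.
Proof.
rewrite -sqrtr_sqr ler_wsqrtr// (bigD1 c)//= lerDl.
by apply: sumr_ge0 => i _; rewrite sqr_ge0.
Qed.

(** [#|C|.+1] is a crude substitute for the square root of [#|C|]; only linearity in [r] matters for
    the covers below. *)
Lemma euclid_dist_le x y (r : R) : 0 <= r ->
  (forall c, `|x c - y c| <= r) -> euclid_dist x y <= #|C|.+1%:R * r.
Proof.
move=> r0 H; rewrite -(ger0_norm (_ : 0 <= #|C|.+1%:R * r)); last first.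
  by rewrite mulr_ge0.
rewrite -sqrtr_sqr ler_wsqrtr//.
apply: (@le_trans _ _ (\sum_(c : C) r ^+ 2)).
  by apply: ler_sum => c _; rewrite -real_normK ?num_real// lerXn2r ?nnegrE.
rewrite sumr_const -[leLHS]mulr_natl exprMn ler_wpM2r ?sqr_ge0//.
rewrite -natrX ler_nat (leq_trans (leqnSn _))//.
by rewrite -[X in (X <= _)%N]expn1 leq_pexp2l.
Qed.

End EuclideanDistance.

(** * Positive and zero Hausdorff measure *)

Section HausdorffBounds.
Context {C : finType} {R : realType}.
Implicit Types (s delta r : R) (A M : set (coordspace C R)) (S : {set C}).
Local Notation dist := (@euclid_dist C R).

(** At [r = 0] the condition [0 < d] forces [0 < s], so the left side is 0 and not the value 1 of
    0^0. *)
Lemma le_powR_expr s r (d : nat) : (0 < d)%N -> 0 <= r <= 1 -> d%:R <= s ->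
  r `^ s <= r ^+ d.
Proof.
move=> d0 /andP[r0 r1] ds; move: r0; rewrite le_eqVlt => /predU1P[<-|r0].
  rewrite powR0 ?exprn_ge0// gt_eqF// (lt_le_trans _ ds)// ltr0n//.
by rewrite -powR_mulrn ?(ltW r0)// ger_powR// r0.
Qed.

Lemma le_expr_powR s r (d : nat) : (0 < d)%N -> 0 <= r <= 1 -> s <= d%:R ->
  r ^+ d <= r `^ s.
Proof.
move=> d0 /andP[r0 r1] ds; move: r0; rewrite le_eqVlt => /predU1P[<-|r0].
  by rewrite expr0n gtn_eqF// powR_ge0.
by rewrite -powR_mulrn ?(ltW r0)// ger_powR// r0.
Qed.

Lemma diam_ge0 A x : A x -> (0 <= diam dist A)%E.
Proof.
move=> Ax; apply: (@le_trans _ _ (dist x x)%:E).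
  by rewrite lee_fin sqrtr_ge0.
by apply: ereal_sup_ubound; exists x => //; exists x.
Qed.

Lemma hweight_le s delta r (d : nat) A :
  (0 < d)%N -> d%:R <= s -> 0 <= r <= 1 -> r <= delta ->
  (forall x y, A x -> A y -> dist x y <= r) ->
  (hweight dist s delta A <= (r ^+ d)%:E)%E.
Proof.
move=> d0 ds /andP[r0 r1] rd Ar; rewrite /hweight; case: asboolP => [_|/eqP/set0P[x Ax]].
  by rewrite lee_fin exprn_ge0.
have dr : (diam dist A <= r%:E)%E.
  by apply: ge_ereal_sup => _ [u Au [v Av <-]]; rewrite lee_fin Ar.
have dA0 := diam_ge0 _ _ Ax.
have dfin : diam dist A \is a fin_num.
  by rewrite ge0_fin_numE// (le_lt_trans dr)// ltry.
rewrite ifT ?(le_trans dr) ?lee_fin//.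
have fr : fine (diam dist A) <= r by rewrite -lee_fin fineK.
have f0 : 0 <= fine (diam dist A) by rewrite -lee_fin fineK.
apply: le_trans (le_powR_expr _ _ _ d0 _ ds) _; first by rewrite f0 (le_trans fr).
by rewrite lerXn2r ?nnegrE.
Qed.

Lemma hcontent_finite_cover s delta r (T : finType) (F : T -> set (coordspace C R)) A :
  (forall x, A x -> exists t, F t x) ->
  (forall t, hweight dist s delta (F t) <= r%:E)%E ->
  (hcontent dist s delta A <= (#|T|%:R * r)%:E)%E.
Proof.
move=> AF Fr.
(* The finite family is padded to a sequence by empty sets, whose weight is 0. *)
pose G i := nth set0 [seq F t | t <- enum T] i.
apply: (@le_trans _ _ (\sum_(i <oo) hweight dist s delta (G i))%E).
  apply: ereal_inf_lbound; exists G => //; split => // x /AF[t Ft].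
  exists (index t (enum T)) => //.
  by rewrite /G (nth_map t) ?index_mem ?mem_enum// nth_index// mem_enum.
rewrite (nneseries_split 0 #|T|); last by move=> *; exact: hweight_ge0.
rewrite add0n eseries0 ?adde0; last first.
  by move=> i Ti _; rewrite /G nth_default ?hweight0// size_map -cardE.
have -> : #|T| = size [seq F t | t <- enum T] by rewrite size_map cardE.
rewrite -(big_nth set0 xpredT) big_map.
apply: (@le_trans _ _ (\sum_(t <- enum T) r%:E)%E); first exact: lee_sum.
by rewrite sumEFin lee_fin big_const_seq count_predT iter_addr_0 size_map mulr_natl.
Qed.

(** If the measure vanished, a cover of small total weight would exist. Enclosing each set of
    diameter D <= 1 in a cube of side 2D, with D^d <= D^s, would give boxes covering the unit cube
    of the S-coordinates with total volume below 1. *)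
Lemma hmeasure_coord_subspace_neq0 s S M : 0 <= s < #|S|%:R ->
  (forall x : coordspace C R, (forall c, c \notin S -> x c = 0) -> M x) ->
  hmeasure dist s M != 0%E.
Proof.
move=> /andP[s0 sS] SM; apply/eqP => M0.
have S0 : (0 < #|S|)%N by rewrite -(ltr0n R) (le_lt_trans s0).
have [c0 c0S] : exists c, c \in S by apply/card_gt0P.
set d := #|S| in sS S0.
(* The sides 2D cost a factor 2^d, so this bound leaves a total volume below 1/2. *)
pose eta : R := (2 ^+ d.+1)^-1.
have eta0 : 0 < eta by rewrite invr_gt0 exprn_gt0.
have : (hcontent dist s 1 M < eta%:E)%E.
  by apply: (le_lt_trans (hcontent_le_hmeasure _ _ _ ltr01)); rewrite M0 lte_fin.
move=> /ereal_inf_lt[_ [F [_ MF] <-] Feta].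
pose p i := xget (0 : coordspace C R) (F i).
pose D i : R := fine (diam dist (F i)).
(* A weight other than [+oo] means diameter at most 1, because [delta] is 1 here. *)
have hF i : (hweight dist s 1 (F i) < +oo)%E.
  apply: le_lt_trans (lt_trans Feta (ltry _)).
  rewrite (nneseries_split 0 i.+1); last by move=> *; exact: hweight_ge0.
  rewrite add0n big_nat_recr//= -addeA addeC -addeA leeDl// adde_ge0//.
    by apply: nneseries_ge0 => *; exact: hweight_ge0.
  by apply: sume_ge0 => *; exact: hweight_ge0.
have FD i : F i !=set0 -> [/\ diam dist (F i) = (D i)%:E, 0 <= D i <= 1 &
    hweight dist s 1 (F i) = (D i `^ s)%:E].
  move=> /[dup] /set0P F0 [x Fx]; have dF0 := diam_ge0 _ _ Fx.
  have := hF i; rewrite /hweight asboolF; last exact/eqP.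
  case: ifP => // dF1 _.
  have DE : diam dist (F i) = (D i)%:E.
    by rewrite fineK// ge0_fin_numE// (le_lt_trans dF1)// ltry.
  by rewrite DE !lee_fin in dF0 dF1 *; rewrite dF0 dF1.
(* The supremum over the empty set is -oo, which [fine] sends to 0. *)
have D0 i : F i = set0 -> D i = 0.
  move=> F0; rewrite /D F0 /diam (_ : [set _ | _ in _ & _ in _] = set0) ?ereal_sup0//.
  by rewrite -subset0 => _ [? []].
have D01 i : 0 <= D i <= 1.
  have [/D0->|/set0P/FD[]//] := eqVneq (F i) set0.
  by rewrite lexx ler01.
have Dp i x : F i x -> forall c, `|x c - p i c| <= D i.
  move=> Fx c; apply: le_trans (coord_le_euclid_dist _ _ _) _.
  have [|DE _ _] := FD i; first by exists x.
  rewrite -lee_fin -DE; apply: ereal_sup_ubound; exists x => //; exists (p i) => //.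
  exact: xgetPex (ex_intro _ x Fx).
have Dw i : ((D i ^+ d)%:E <= hweight dist s 1 (F i))%E.
  have [/D0->|/set0P/FD[_ Di ->]] := eqVneq (F i) set0.
    by rewrite expr0n gtn_eqF//= hweight_ge0.
  by rewrite lee_fin le_expr_powR// ltW.
pose a i j := p i (nth c0 (enum S) j) - D i.
pose b i j := p i (nth c0 (enum S) j) + D i.
have ab i j : a i j <= b i j.
  by rewrite /a /b lerBlDr -addrA lerDl addr_ge0//; have /andP[] := D01 i.
have := box_cover_volume R d (fun=> 1) a b (fun=> ler01) ab.
suff cov : forall x : nat -> R, (forall j, 0 <= x j <= 1)%R ->
    ((1 : \bar R) <= \sum_(i <oo) (1 * \prod_(j < d) \1_(`[a i j, b i j]%classic) (x j))%:E)%E.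
  move=> /(_ cov); apply/negP; rewrite -ltNge.
  apply: (@le_lt_trans _ _ (\sum_(i <oo) (2 ^+ d)%:E * hweight dist s 1 (F i))%E).
    apply: lee_nneseries => [i _ _|i _].
      by rewrite lee_fin mul1r prodr_ge0// => j _; rewrite subr_ge0.
    rewrite (eq_bigr (fun=> 2 * D i)); last first.
      by move=> j _; rewrite /a /b; ring.
    rewrite prodr_const card_ord mul1r exprMn EFinM lee_wpmul2l// lee_fin exprn_ge0//.
  rewrite nneseriesZl; last by move=> *; exact: hweight_ge0.
  apply: (@lt_trans _ _ ((2 ^+ d)%:E * eta%:E)%E).
    by rewrite lte_pmul2l// lte_fin exprn_gt0.
  rewrite -EFinM lte_fin /eta exprS invfM mulrCA mulfV ?mulr1 ?expf_neq0//.
  lra.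
move=> x x01.
(* The cube point is spread over the S-coordinates in the order of [enum S], with zeros elsewhere,
   to land in [M]. *)
pose z : coordspace C R := [ffun c => if c \in S then x (index c (enum S)) else 0].
have /MF[i _ Fz] : M z by apply: SM => c cS; rewrite ffunE (negbTE cS).
apply: (@le_trans _ _ ((1 * \prod_(j < d) \1_(`[a i j, b i j]%classic) (x j))%:E)).
  rewrite mul1r big1// => j _; rewrite indicE mem_set//= in_itv/= /a /b.
  have jS : (j < size (enum S))%N by rewrite -cardE.
  have := Dp _ _ Fz (nth c0 (enum S) j).
  rewrite ffunE -mem_enum mem_nth// index_uniq ?enum_uniq//.
  by rewrite ler_norml => /andP[? ?]; apply/andP; split; lra.
have P0 k : (0 <= (1 * \prod_(j < d) \1_(`[a k j, b k j]%classic) (x j))%:E)%E.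
  by rewrite lee_fin mul1r prodr_ge0// => j _; rewrite indicE.
rewrite (nneseries_split 0 i.+1)//.
rewrite add0n big_nat_recr//= -addeA addeC -addeA leeDl// adde_ge0//.
  by apply: nneseries_ge0.
by apply: sume_ge0.
Qed.

Lemma hdim_coord_subspace_ge S M :
  (forall x : coordspace C R, (forall c, c \notin S -> x c = 0) -> M x) ->
  (#|S|%:R%:E <= hdim dist M)%E.
Proof.
move=> SM; apply: le_ereal_inf_tmp => _ [s [s0 M0] <-]; rewrite lee_fin leNgt.
apply/negP => sS; have := hmeasure_coord_subspace_neq0 s S M _ SM.
by rewrite s0 sS M0 eqxx => /(_ isT).
Qed.

(* Cut the S-coordinates into cells of side 1/N: there are O(N^#|S|) of them, each
   meeting A in a set of diameter O(1/N). *)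
Lemma hmeasure_lipschitz_coords_null s S (K : nat) (L : R) A :
  #|S|.+1%:R <= s -> 0 <= L ->
  (forall x c, A x -> `|x c| <= K%:R) ->
  (forall x y e, A x -> A y -> 0 <= e ->
    (forall c, c \in S -> `|x c - y c| <= e) -> forall c, `|x c - y c| <= L * e) ->
  hmeasure dist s A = 0%E.
Proof.
move=> Ss L0 AK AL.
apply/eqP; rewrite eq_le hmeasure_ge0 andbT.
apply: ge_ereal_sup => _ [delta /= delta0 <-].
apply/lee_addgt0Pr => e e0; rewrite add0e.
pose c : R := #|C|.+1%:R * L.
have c0 : 0 <= c by rewrite mulr_ge0.
(* [B / N] will dominate the number of cells times [r ^+ #|S|.+1]; the exponent exceeds [#|S|] by
   one, which leaves a factor 1/N. *)
pose B : R := (2 * K.+1)%:R ^+ #|S| * c ^+ #|S|.+1.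
have B0 : 0 <= B by rewrite mulr_ge0 ?exprn_ge0.
(* The three summands make [c / N] at most 1, [c / N] at most [delta], and [B / N] at most [e]. *)
pose N := (Num.truncn (c + c / delta + B / e)).+1.
have N0 : 0 < N%:R :> R by rewrite ltr0n.
have Ngt : c + c / delta + B / e <= N%:R by rewrite ltW// truncnS_gt.
have cd0 : 0 <= c / delta by rewrite divr_ge0// ltW.
have Be0 : 0 <= B / e by rewrite divr_ge0// ltW.
pose r := c / N%:R.
have r0 : 0 <= r by rewrite divr_ge0.
have r1 : r <= 1 by rewrite ler_pdivrMr// mul1r; lra.
have rd : r <= delta by rewrite ler_pdivrMr// mulrC -ler_pdivrMr//; lra.
have BN : B / N%:R <= e by rewrite ler_pdivrMr// mulrC -ler_pdivrMr//; lra.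
(* Coordinates shifted by [K] lie in [0, 2K], so cell indices run from 0 to 2KN. *)
pose q (x : coordspace C R) a := Num.truncn ((x a + K%:R) * N%:R).
pose Q := (2 * K * N)%N.
have qle x a : A x -> (q x a < Q.+1)%N.
  move=> Ax; rewrite ltnS /q /Q truncn_le_nat.
  have := AK x a Ax; rewrite ler_norml => /andP[_ xK].
  apply: (@le_lt_trans _ _ ((2 * K * N)%:R)); last by rewrite ltr_nat.
  by rewrite !natrM ler_wpM2r// mulr2n mulrDl mul1r lerD2r.
have qdist x y a : A x -> A y -> q x a = q y a -> `|x a - y a| <= N%:R^-1.
  move=> Ax Ay qxy.
  have ge0 z : A z -> 0 <= (z a + K%:R) * N%:R.
    move=> /(AK z a); rewrite ler_norml => /andP[? _].
    by rewrite mulr_ge0//; lra.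
  have /andP[x1 x2] := truncn_itv (ge0 _ Ax).
  have /andP[y1 y2] := truncn_itv (ge0 _ Ay).
  rewrite -/(q x a) qxy -natr1 in x1 x2.
  rewrite -/(q y a) -natr1 in y1 y2.
  rewrite -[leRHS]mul1r ler_pdivlMr// -[X in _ * X]gtr0_norm// -normrM ler_norml.
  by apply/andP; split; lra.
pose T := {ffun {a | a \in S} -> 'I_Q.+1}.
pose F (v : T) : set (coordspace C R) :=
  [set x | A x /\ forall u, q x (val u) = v u].
apply: (@le_trans _ _ ((#|T|%:R * r ^+ #|S|.+1)%:E)).
  apply: (@hcontent_finite_cover s delta (r ^+ #|S|.+1) T F).
    move=> x Ax; exists [ffun u : {a | a \in S} => Ordinal (qle x (val u) Ax)].
    by split => // u; rewrite ffunE.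
  move=> v; apply: hweight_le => //; first by rewrite r0 r1.
  move=> x y [Ax xv] [Ay yv].
  apply: (@le_trans _ _ (#|C|.+1%:R * (L / N%:R))); last by rewrite /r /c mulrA.
  apply: euclid_dist_le; first by rewrite divr_ge0.
  apply: (AL x y N%:R^-1) => //.
  move=> a aS; apply: qdist => //.
  by have := xv (exist _ a aS); have := yv (exist _ a aS) => /= -> ->.
rewrite lee_fin; apply: le_trans BN.
rewrite card_ffun card_ord card_sig.
rewrite (_ : #|[pred x | x \in S]| = #|S|); last by apply: eq_card.
rewrite natrX /r /B expr_div_n [N%:R ^+ _.+1]exprS.
rewrite [leRHS](_ : _ = ((2 * K.+1)%:R * N%:R) ^+ #|S| *
  (c ^+ #|S|.+1 / (N%:R * N%:R ^+ #|S|))); last first.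
  have cancel (p v t z : R) : t != 0 -> z != 0 -> p * v / z = p * t * (v / (z * t)).
    by move=> t0 z0; field; rewrite z0 t0.
  by rewrite [(_ * N%:R) ^+ _]exprMn; apply: cancel; rewrite ?expf_neq0 ?gt_eqF.
rewrite ler_wpM2r//.
  by rewrite divr_ge0 ?exprn_ge0// mulr_ge0 ?exprn_ge0.
rewrite lerXn2r ?nnegrE ?mulr_ge0// -natrM ler_nat /Q.
by rewrite mulnS mulnDl -[X in (X <= _)%N]add1n leq_add2r muln_gt0.
Qed.

End HausdorffBounds.

(** * Pivot blocks and their padded inverses *)

Section Pivots.
Context {F : fieldType} {m : nat}.
Implicit Types (I J : {set 'I_m}) (X Y V W : 'M[F]_m).

Definition proj_mx_set J : 'M[F]_m := diag_mx (\row_j (j \in J)%:R).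
Local Notation "''E_' J" := (proj_mx_set J) (at level 8, J at level 2).

Lemma proj_mx_setE J a b : 'E_J a b = ((a == b) && (a \in J))%:R.
Proof. by rewrite !mxE; case: eqP => [->|_] /=; case: (_ \in _). Qed.

Lemma mul_proj_mx_set J X a b : ('E_J *m X) a b = (a \in J)%:R * X a b.
Proof. by rewrite mul_diag_mx !mxE. Qed.

Lemma mul_mx_proj_set J X a b : (X *m 'E_J) a b = X a b * (b \in J)%:R.
Proof. by rewrite mul_mx_diag !mxE. Qed.

Lemma proj_mx_setC J : 'E_(~: J) = 1%:M - 'E_J.
Proof.
apply/matrixP => a b; rewrite !mxE inE.
by case: eqP => [->|_] /=; case: (_ \in _); rewrite ?subrr ?subr0.
Qed.

Lemma proj_mx_set_mul I J : 'E_I *m 'E_J = 'E_(I :&: J).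
Proof.
apply/matrixP => a b; rewrite mul_proj_mx_set !proj_mx_setE inE -natrM mulnb.
by rewrite andbCA.
Qed.

(* The block X[I, J] is invertible of full rank and W is its inverse, padded
   with zeros outside J x I. *)
Definition pivoted I J X W : Prop :=
  [/\ 'E_J *m W *m 'E_I = W, 'E_I *m X *m W = 'E_I,
      W *m X *m 'E_J = 'E_J & X *m W *m X = X].

(** Independent rows [f] are chosen first, then independent columns [g] of the selected rows. The
    resulting block [P] is invertible, and [W] is [invmx P] put back in place by selection
    matrices. *)
Lemma pivoted_exists X :
  exists I J W, [/\ pivoted I J X W, #|I| = \rank X & #|J| = \rank X].
Proof.
pose r := \rank X; pose f := maxrankfun X.
have fullfX : row_full (rowsub f X)^T.
  by rewrite /row_full mxrank_tr -/(row_free _) maxrowsub_free.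
pose g := fullrankfun fullfX.
pose P := (rowsub g (rowsub f X)^T)^T.
have uP : P \in unitmx by rewrite unitmx_tr fullrowsub_unit.
pose S (h : {ffun 'I_r -> 'I_m}) : 'M[F]_(r, m) := rowsub h 1%:M.
have SX (h : {ffun 'I_r -> 'I_m}) : injective h -> S h *m (S h)^T = 1%:M.
  move=> hi; apply/matrixP => a b; rewrite !mxE (bigD1 (h a))//= big1 ?addr0.
    by rewrite !mxE eqxx mul1r eq_sym (inj_eq hi).
  by move=> c ca; rewrite !mxE eq_sym (negbTE ca) mul0r.
have SE (h : {ffun 'I_r -> 'I_m}) : injective h ->
    (S h)^T *m S h = 'E_([set a in codom h]%SET).
  move=> hi; apply/matrixP => a b; rewrite proj_mx_setE inE !mxE.
  have [/codomP[c ->]|ac] := boolP (a \in codom h).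
    rewrite (bigD1 c)//= big1 ?addr0.
      by rewrite !mxE eqxx mul1r andbT.
    by move=> c' cc'; rewrite !mxE (inj_eq hi) (negbTE cc') mul0r.
  rewrite andbF big1// => c _; rewrite !mxE.
  by case: eqP => [ca|_]; rewrite ?mul0r//; case/negP: ac; rewrite -ca codom_f.
have fi : injective f := @maxrankfun_inj _ _ _ _.
have gi : injective g := @fullrankfun_inj _ _ _ _ _.
have PE : S f *m X *m (S g)^T = P.
  by rewrite /P [rowsub g _]rowsubE trmx_mul trmxK [rowsub f X]rowsubE.
(* All rows of [X] are combinations of the pivot rows; this is what gives [X *m W *m X = X]. *)
have /submxP[Q XQ] : (X <= S f *m X)%MS by rewrite /S -rowsubE eq_maxrowsub.
exists ([set a in codom f]%SET), ([set a in codom g]%SET).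
exists ((S g)^T *m invmx P *m S f); split; last 2 first.
- by rewrite cardsE card_codom// card_ord.
- by rewrite cardsE card_codom// card_ord.
rewrite /pivoted -!SE//; split.
- by rewrite !mulmxA -[_ *m S g *m (S g)^T]mulmxA SX// mulmx1
    -[_ *m S f *m (S f)^T]mulmxA SX// mulmx1.
- rewrite -!mulmxA; congr (_ *m _); rewrite !mulmxA PE.
  by rewrite mulmxV// mul1mx.
- rewrite !mulmxA -[_ *m S f *m X *m _]mulmxA -[_ *m S f *m _]mulmxA.
  by rewrite [S f *m _]mulmxA PE -[_ *m _ *m P]mulmxA mulVmx// mulmx1.
rewrite {1}XQ !mulmxA -[Q *m S f *m X *m _]mulmxA -[Q *m S f *m _]mulmxA.
rewrite [S f *m _]mulmxA PE -[Q *m P *m _]mulmxA mulmxV// mulmx1.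
by rewrite -!mulmxA -XQ.
Qed.

(* Multiplying X' X = 0 by W' expresses the rows of X in J' through the other
   rows of X. *)
Lemma pivoted_kernel I' J' X' W' X : pivoted I' J' X' W' -> X' *m X = 0 ->
  X = (1%:M - W' *m X') *m ('E_(~: J') *m X).
Proof.
move=> [_ _ WXE _] XX0; rewrite proj_mx_setC !mulmxBl !mul1mx mulmxBr.
by rewrite -(mulmxA W' X' X) XX0 mulmx0 (mulmxA (W' *m X')) WXE sub0r opprK subrK.
Qed.

(** By [pivoted_kernel] the rows of [X] outside [J'] already have its full rank. Pivots are
    therefore taken from the matrix with the rows in [J'] erased, and then carried back to [X]. *)
Lemma pivoted_next_exists I' J' X' W' X : pivoted I' J' X' W' -> X' *m X = 0 ->
  exists I J W, [/\ pivoted I J X W, I \subset ~: J', #|I| = \rank X &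
                    #|J| = \rank X].
Proof.
move=> piv XX0; have XN := pivoted_kernel _ _ _ _ _ piv XX0.
have rkZ : \rank ('E_(~: J') *m X) = \rank X.
  by apply/eqP; rewrite eqn_leq mxrankM_maxr {1}XN mxrankM_maxr.
have [I [J [W [[EWE EXW WXE XWX]]]]] := pivoted_exists ('E_(~: J') *m X).
rewrite rkZ => cI cJ; exists I, J, W.
(* A pivot row in [J'] would be an erased row, contradicting the diagonal entry 1 in [EXW]. *)
have IJ0 a : a \in I -> a \notin J'.
  move=> aI; apply/negP => aJ; move/matrixP/(_ a a) : EXW.
  rewrite proj_mx_setE eqxx aI !mulmxA proj_mx_set_mul -mulmxA mul_proj_mx_set.
  by rewrite !inE aJ andbF mul0r => /eqP; rewrite eq_sym oner_eq0.
have EIC : 'E_I *m 'E_(~: J') = 'E_I.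
  by rewrite proj_mx_set_mul; congr 'E_ _;
    apply/finset.setIidPl/fintype.subsetP => a /IJ0; rewrite inE.
have WX : W *m X = W *m ('E_(~: J') *m X).
  by rewrite -EWE -!mulmxA; congr (_ *m (_ *m _)); rewrite mulmxA EIC.
split => //; last first.
  by apply/fintype.subsetP => a /IJ0; rewrite inE.
split => //.
- by rewrite mulmxA EIC in EXW.
- by rewrite WX.
- by rewrite -mulmxA WX {1}XN -!mulmxA; rewrite -!mulmxA in XWX; rewrite XWX -XN.
Qed.

End Pivots.

(** * Lipschitz dependence of a matrix on its free entries *)

Section PivotLipschitz.
Context {R : realType} {m : nat}.
Implicit Types (A B X Y V W : 'M[R]_m) (I J : {set 'I_m}).
Local Notation "''E_' J" := (proj_mx_set J) (at level 8, J at level 2).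

(** The entrywise l1 norm is used because it is submultiplicative and bounds every entry. *)
Definition mx_sum_norm A : R := \sum_i \sum_j `|A i j|.
Local Notation nrm := mx_sum_norm.

Lemma mx_sum_norm_ge0 A : 0 <= nrm A.
Proof. by apply: sumr_ge0 => i _; apply: sumr_ge0. Qed.

Lemma mx_sum_normD A B : nrm (A + B) <= nrm A + nrm B.
Proof.
rewrite /nrm -big_split; apply: ler_sum => i _ /=.
by rewrite -big_split; apply: ler_sum => j _ /=; rewrite mxE ler_normD.
Qed.

Lemma mx_sum_normN A : nrm (- A) = nrm A.
Proof.
by apply: eq_bigr => i _; apply: eq_bigr => j _; rewrite mxE normrN.
Qed.

Lemma mx_sum_norm0 : nrm 0 = 0.
Proof. by rewrite /nrm big1// => i _; rewrite big1// => j _; rewrite mxE normr0. Qed.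

Lemma mx_sum_normM A B : nrm (A *m B) <= nrm A * nrm B.
Proof.
rewrite /nrm mulr_suml; apply: ler_sum => i _.
apply: (@le_trans _ _ (\sum_j \sum_k `|A i k| * `|B k j|)).
  apply: ler_sum => j _; rewrite mxE; apply: le_trans (ler_norm_sum _ _ _) _.
  by apply: ler_sum => k _; rewrite normrM.
rewrite exchange_big/= mulr_suml; apply: ler_sum => k _.
rewrite -mulr_sumr ler_wpM2l// [leRHS](bigD1 k)//= lerDl.
by apply: sumr_ge0 => l _; apply: sumr_ge0.
Qed.

Lemma entry_le_mx_sum_norm A i j : `|A i j| <= nrm A.
Proof.
apply: (@le_trans _ _ (\sum_l `|A i l|)).
  by rewrite (bigD1 j)//= lerDl; apply: sumr_ge0.
rewrite /nrm [leRHS](bigD1 i)//= lerDl.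
by apply: sumr_ge0 => k _; apply: sumr_ge0.
Qed.

Lemma mx_sum_norm_le A e : (forall i j, `|A i j| <= e) -> nrm A <= (m * m)%:R * e.
Proof.
move=> Ae; apply: (@le_trans _ _ (\sum_(i < m) \sum_(j < m) e)).
  by apply: ler_sum => i _; apply: ler_sum.
by rewrite !sumr_const !card_ord -mulrnA mulr_natl.
Qed.

Lemma mx_sum_normM_le A B a b : nrm A <= a -> nrm B <= b -> nrm (A *m B) <= a * b.
Proof.
move=> Aa Bb; apply: le_trans (mx_sum_normM _ _) _.
by rewrite ler_pM// mx_sum_norm_ge0.
Qed.

Lemma mx_sum_normD_le A B a b : nrm A <= a -> nrm B <= b -> nrm (A + B) <= a + b.
Proof. by move=> Aa Bb; apply: le_trans (mx_sum_normD _ _) _; rewrite lerD. Qed.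

Arguments mx_sum_normM_le {A B a b}.
Arguments mx_sum_normD_le {A B a b}.

Lemma mx_sum_norm_proj J : nrm 'E_J <= (m * m)%:R.
Proof.
rewrite -[leRHS]mulr1; apply: mx_sum_norm_le => i j.
by rewrite proj_mx_setE; case: (_ && _); rewrite ?normr1 ?normr0.
Qed.

Lemma proj_mx_setT : 'E_[set: 'I_m]%SET = 1%:M :> 'M[R]_m.
Proof. by apply/matrixP => a b; rewrite proj_mx_setE !mxE inE andbT. Qed.

(** This is the inductive step along the complex, with primes for the preceding differential. The
    pivot rows control the padded inverse, the kernel relation recovers the pivot columns, and these
    together determine the whole matrix. The constant depends only on [m], [K] and [L]. *)
Lemma pivoted_lipschitz (K L : R) : 0 <= K -> 0 <= L -> exists2 c : R, 0 <= c &
  forall I J X W Y V I' J' X' W' Y' V' e, 0 <= e ->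
  pivoted I' J' X' W' -> pivoted I' J' Y' V' -> X' *m X = 0 -> Y' *m Y = 0 ->
  pivoted I J X W -> pivoted I J Y V -> I \subset ~: J' ->
  nrm X <= K -> nrm W <= K -> nrm Y <= K -> nrm V <= K ->
  nrm X' <= K -> nrm W' <= K -> nrm Y' <= K -> nrm V' <= K ->
  nrm (X' - Y') <= L * e -> nrm (W' - V') <= L * e ->
  (forall a b, a \notin J' -> (a \in I) || (b \in J) -> `|X a b - Y a b| <= e) ->
  nrm (X - Y) <= c * e /\ nrm (W - V) <= c * e.
Proof.
move=> K0 L0; pose M : R := (m * m)%:R.
have M0 : 0 <= M by [].
(* [cW], [cJ] and [cX] bound the variation of the padded inverse, of the pivot columns and of the
   matrix; [M] bounds the norm of every coordinate projection. *)
pose cW := K * M * K.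
pose cJ := (M + K * K) * M + (K * L + L * K) * (M * (K * M)).
pose cX := cJ * (K * (M * K)) + (K * M) * (cW * (M * K) + K * M).
exists (cX + cW).
  by rewrite addr_ge0 /cX /cJ /cW ?(addr_ge0, mulr_ge0).
move=> I J X W Y V I' J' X' W' Y' V' e e0 pX' pY' XX0 YY0 pX pY IJ'.
move=> nX nW nY nV nX' nW' nY' nV' dX' dW' close.
have [EWE EXW WXE XWX] := pX; have [EVE EYV VYE YVY] := pY.
have dEI : nrm ('E_I *m (X - Y)) <= M * e.
  apply: mx_sum_norm_le => a b; rewrite mul_proj_mx_set.
  have [aI|aI] := boolP (a \in I); last by rewrite mul0r normr0.
  rewrite mul1r !mxE close ?aI//.
  by have /fintype.subsetP/(_ _ aI) := IJ'; rewrite inE.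
have dEJ : nrm ('E_(~: J') *m (X - Y) *m 'E_J) <= M * e.
  apply: mx_sum_norm_le => a b; rewrite mul_mx_proj_set mul_proj_mx_set inE.
  have [aJ|aJ] := boolP (a \in J'); first by rewrite !mul0r normr0.
  have [bJ|bJ] := boolP (b \in J); last by rewrite mulr0 normr0.
  by rewrite mul1r mulr1 !mxE close// bJ orbT.
have WIE : W *m 'E_I = W by rewrite -{1}EWE -[LHS]mulmxA proj_mx_set_mul finset.setIid.
have EJV : 'E_J *m V = V by rewrite -{1}EVE !mulmxA proj_mx_set_mul finset.setIid.
(* The resolvent identity A^-1 - B^-1 = - A^-1 (A - B) B^-1 for padded inverses: only the pivot rows
   of [X - Y] enter. *)
have WV : W - V = - (W *m ('E_I *m (X - Y)) *m V).
  rewrite !mulmxA WIE mulmxBr mulmxBl -{2}EJV !mulmxA WXE EJV.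
  by rewrite -{2}WIE -!mulmxA [_ *m (Y *m V)]mulmxA EYV WIE opprB.
have dWV : nrm (W - V) <= cW * e.
  rewrite WV mx_sum_normN (_ : cW * e = K * (M * e) * K); last by rewrite /cW; ring.
  exact: mx_sum_normM_le (mx_sum_normM_le nW dEI) nV.
have nE I0 : nrm 'E_I0 <= M by exact: mx_sum_norm_proj.
have dXJ : nrm (X *m 'E_J - Y *m 'E_J) <= cJ * e.
  rewrite {1}(pivoted_kernel _ _ _ _ _ pX' XX0) {1}(pivoted_kernel _ _ _ _ _ pY' YY0).
  have -> : (1%:M - W' *m X') *m ('E_(~: J') *m X) *m 'E_J -
      (1%:M - V' *m Y') *m ('E_(~: J') *m Y) *m 'E_J =
      (1%:M - W' *m X') *m ('E_(~: J') *m (X - Y) *m 'E_J) +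
      - ((W' *m (X' - Y') + (W' - V') *m Y') *m ('E_(~: J') *m (Y *m 'E_J))).
    rewrite !(mulmxBl, mulmxBr, mulmxDl, mulNmx, mul1mx, mulmxA).
    by apply/matrixP => a b; rewrite !mxE; ring.
  rewrite (_ : cJ * e = (M + K * K) * (M * e) +
    (K * (L * e) + (L * e) * K) * (M * (K * M))); last by rewrite /cJ; ring.
  apply: mx_sum_normD_le.
    apply: mx_sum_normM_le dEJ; apply: mx_sum_normD_le.
      by rewrite -proj_mx_setT.
    by rewrite mx_sum_normN; exact: mx_sum_normM_le.
  rewrite mx_sum_normN; apply: mx_sum_normM_le.
    exact: mx_sum_normD_le (mx_sum_normM_le nW' dX') (mx_sum_normM_le dW' nY').
  exact: mx_sum_normM_le (nE _) (mx_sum_normM_le nY (nE _)).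
(* Pivot columns times padded inverse times pivot rows give back the matrix. *)
have XJI A B I0 J0 : 'E_J0 *m B *m 'E_I0 = B -> A *m B *m A = A ->
    A = (A *m 'E_J0) *m (B *m ('E_I0 *m A)).
  by move=> EB ABA; rewrite -{1}ABA -{1}EB !mulmxA.
have dX : nrm (X - Y) <= cX * e.
  rewrite {1}(XJI _ _ _ _ EWE XWX) {1}(XJI _ _ _ _ EVE YVY).
  have -> : X *m 'E_J *m (W *m ('E_I *m X)) - Y *m 'E_J *m (V *m ('E_I *m Y)) =
      (X *m 'E_J - Y *m 'E_J) *m (W *m ('E_I *m X)) +
      (Y *m 'E_J) *m ((W - V) *m ('E_I *m X) + V *m ('E_I *m (X - Y))).
    rewrite !(mulmxBl, mulmxBr, mulmxDr, mulmxA).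
    by apply/matrixP => a b; rewrite !mxE; ring.
  rewrite (_ : cX * e = cJ * e * (K * (M * K)) +
    (K * M) * (cW * e * (M * K) + K * (M * e))); last by rewrite /cX; ring.
  have nEX := mx_sum_normM_le (nE I) nX.
  apply: mx_sum_normD_le (mx_sum_normM_le dXJ (mx_sum_normM_le nW nEX)) _.
  apply: mx_sum_normM_le (mx_sum_normM_le nY (nE _)) _.
  exact: mx_sum_normD_le (mx_sum_normM_le dWV nEX) (mx_sum_normM_le nV dEI).
have cW0 : 0 <= cW by rewrite /cW !mulr_ge0.
have cX0 : 0 <= cX by rewrite /cX /cJ ?(addr_ge0, mulr_ge0).
by split; [apply: le_trans dX _|apply: le_trans dWV _];
  rewrite ler_wpM2r// ?lerDl ?lerDr.
Qed.

End PivotLipschitz.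

(** * Differentials indexed by natural numbers *)

Section Differentials.
Context {R : realType} {n m : nat}.
Implicit Types (x y : cspace R n m) (i : nat).

(* The differential d_i for every natural number i, with d_i = 0 outside
   1, ..., n. *)
Definition differential x i : 'M[R]_m :=
  if i is i'.+1 then
    if (insub i' : option 'I_n) is Some j then cmap x j else 0
  else 0.

Lemma differential_ord x (i : 'I_n) : differential x i.+1 = cmap x i.
Proof. by rewrite /= valK. Qed.

Lemma crankE x i : crank x i = \rank (differential x i).
Proof.
case: i => [|i] /=; first by rewrite mxrank0.
by case: insubP => [//|_]; rewrite mxrank0.
Qed.

Lemma differential_comp x i : chain_complexes R n m x ->
  differential x i *m differential x i.+1 = 0.
Proof.
move=> Mx; case: i => [|i]; first by rewrite mul0mx.
rewrite /=; case: insubP => [j _ ji|_]; last by rewrite mul0mx.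
case: insubP => [l _ li|_]; last by rewrite mulmx0.
by apply: Mx; rewrite li ji.
Qed.

End Differentials.

(** * Pieces of the variety with fixed pivots and bounded data *)

Section Pieces.
Context {R : realType} {n m : nat}.
Local Notation pivots := (seq ({set 'I_m} * {set 'I_m})).
Implicit Types (x y : cspace R n m) (p : pivots).

(** Pivots are stored in a sequence, so that pieces are indexed by a countable type; entry i belongs
    to [differential x i], with d_0 = 0 included. *)
Definition pivot_rows p i := (nth (finset.set0, finset.set0) p i).1.
Definition pivot_cols p i := (nth (finset.set0, finset.set0) p i).2.
Local Notation I_ p := (pivot_rows p).
Local Notation J_ p := (pivot_cols p).

(** Bounding the padded inverses as well as the differentials by [K] gives one Lipschitz constant on
    the whole piece. *)
Definition chain_piece p (K : nat) : set (cspace R n m) :=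
  [set x | chain_complexes R n m x /\ exists W : nat -> 'M[R]_m,
     forall i, (i <= n)%N ->
       [/\ pivoted (I_ p i) (J_ p i) (differential x i) (W i),
           mx_sum_norm (differential x i) <= K%:R & mx_sum_norm (W i) <= K%:R]].

(* The entries of a complex that determine it on a piece: the rows of d_(i+1)
   in J_i are recovered from d_i d_(i+1) = 0, and what remains from the pivot
   rows and columns. *)
Definition free_coords p : {set cindex n m} :=
  [set c : cindex n m | (c.1.2 \notin J_ p c.1.1) &&
     ((c.1.2 \in I_ p c.1.1.+1) || (c.2 \in J_ p c.1.1.+1))]%SET.

Definition pivots_compatible p :=
  forall i, (i < n)%N -> I_ p i.+1 \subset ~: J_ p i.

(** Induction along the complex controls the differentials and their padded inverses together, since
    each step consumes both. *)
Lemma chain_piece_lipschitz p (K : nat) : pivots_compatible p ->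
  exists2 L : R, 0 <= L & forall x y e, chain_piece p K x -> chain_piece p K y ->
    0 <= e -> (forall c, c \in free_coords p -> `|x c - y c| <= e) ->
    forall c, `|x c - y c| <= L * e.
Proof.
move=> comp.
pose P x (W : nat -> 'M[R]_m) i :=
  [/\ pivoted (I_ p i) (J_ p i) (differential x i) (W i),
      mx_sum_norm (differential x i) <= K%:R & mx_sum_norm (W i) <= K%:R].
suff main i : (i <= n)%N -> exists2 L : R, 0 <= L & forall x y W V e,
    chain_complexes R n m x -> chain_complexes R n m y ->
    (forall j, (j <= n)%N -> P x W j) -> (forall j, (j <= n)%N -> P y V j) ->
    0 <= e -> (forall c, c \in free_coords p -> `|x c - y c| <= e) ->
    forall j, (j <= i)%N ->
    mx_sum_norm (differential x j - differential y j) <= L * e /\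
    mx_sum_norm (W j - V j) <= L * e.
  have [L L0 HL] := main n (leqnn n); exists L => //.
  move=> x y e [Mx [W PW]] [My [V PV]] e0 xy [[i a] b].
  have [+ _] := HL _ _ _ _ _ Mx My PW PV e0 xy i.+1 (ltn_ord i).
  apply: le_trans; have := entry_le_mx_sum_norm
    (differential x i.+1 - differential y i.+1) a b.
  by rewrite !differential_ord !mxE.
elim: i => [_|i IHi ltin].
  exists 0 => // x y W V e _ _ PW PV e0 _ j; rewrite leqn0 => /eqP ->.
  (* With d_0 = 0 the relation [W *m X *m 'E_J = 'E_J] kills the projection on [J], hence [W]
     too. *)
  have W0 z U : P z U 0%N -> U 0%N = 0.
    move=> [[EWE _ WXE _] _ _].
    by rewrite -EWE -WXE /= mulmx0 !mul0mx.
  rewrite (W0 _ _ (PW 0%N _))// (W0 _ _ (PV 0%N _))//= subr0 mx_sum_norm0.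
  by rewrite mul0r lexx.
have [L L0 HL] := IHi (ltnW ltin).
have [c c0 Hc] := @pivoted_lipschitz R m K%:R L (ler0n _ _) L0.
(* The sum serves both the earlier indices, through [L], and the new one, through [c]. *)
exists (L + c); first exact: addr_ge0.
move=> x y W V e Mx My PW PV e0 xy j.
rewrite leq_eqVlt ltnS => /predU1P[->|ji]; last first.
  have [dX dW] := HL _ _ _ _ _ Mx My PW PV e0 xy _ ji.
  by split; [apply: le_trans dX _|apply: le_trans dW _]; rewrite ler_wpM2r// lerDl.
have [dX' dW'] := HL _ _ _ _ _ Mx My PW PV e0 xy _ (leqnn i).
have [pX nX nW] := PW _ ltin; have [pY nY nV] := PV _ ltin.
have [pX' nX' nW'] := PW _ (ltnW ltin); have [pY' nY' nV'] := PV _ (ltnW ltin).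
have [] := Hc _ _ _ _ _ _ _ _ _ _ _ _ e e0 pX' pY' (differential_comp _ _ Mx)
  (differential_comp _ _ My) pX pY (comp _ ltin) nX nW nY nV nX' nW' nY' nV' dX' dW'.
  move=> a b aJ abIJ; have := xy (Ordinal ltin, a, b).
  rewrite (differential_ord x (Ordinal ltin)) (differential_ord y (Ordinal ltin)) !mxE.
  by apply; rewrite inE /= aJ.
move=> dX dW.
by split; [apply: le_trans dX _|apply: le_trans dW _]; rewrite ler_wpM2r// lerDr.
Qed.

Lemma chain_piece_null p (K : nat) (s : R) : pivots_compatible p ->
  #|free_coords p|.+1%:R <= s ->
  hmeasure (@euclid_dist (cindex n m) R) s (chain_piece p K) = 0%E.
Proof.
move=> comp Ss; have [L L0 HL] := chain_piece_lipschitz p K comp.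
apply: (hmeasure_lipschitz_coords_null s (free_coords p) K L) => //.
move=> x [[i a] b] [_ [W PW]]; have [_ + _] := PW _ (ltn_ord i).
apply: le_trans; have := entry_le_mx_sum_norm (differential x i.+1) a b.
by rewrite differential_ord !mxE.
Qed.

(** Pivots are chosen recursively, those of d_(i+1) depending on those of d_i; [K] then exceeds the
    finitely many norms involved. *)
Lemma chain_piece_exists x : chain_complexes R n m x -> exists p K,
  [/\ chain_piece p K x, pivots_compatible p &
      forall i, (i <= n)%N -> #|I_ p i| = crank x i /\ #|J_ p i| = crank x i].
Proof.
move=> Mx.
pose T := ({set 'I_m} * {set 'I_m} * 'M[R]_m)%type.
pose P i (t : T) := [/\ pivoted t.1.1 t.1.2 (differential x i) t.2,
  #|t.1.1| = crank x i & #|t.1.2| = crank x i].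
have [t0 Pt0] : exists t0, P 0%N t0.
  have [I [J [W [pIJ cI cJ]]]] := pivoted_exists (differential x 0).
  by exists (I, J, W); split => //; rewrite crankE.
(* The implication sits under the existential, so that choice yields a total function even where
   [P i t] fails. *)
have step i t : exists t', P i t -> P i.+1 t' /\ t'.1.1 \subset ~: t.1.2.
  have [[pIJ _ _]|nP] := pselect (P i t); last by exists t.
  have [I [J [W [pIJ' IJ cI cJ]]]] :=
    pivoted_next_exists _ _ _ _ _ pIJ (differential_comp x i Mx).
  by exists (I, J, W) => _; split => //; split => //; rewrite crankE.
have [f Hf] : {f : nat -> T -> T &
    forall i t, P i t -> P i.+1 (f i t) /\ (f i t).1.1 \subset ~: t.1.2}.
  by have [f Hf] := choice (fun u : nat * T => step u.1 u.2);
    exists (fun i t => f (i, t)) => i t; exact: (Hf (i, t)).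
pose g := fix g i := if i is i'.+1 then f i' (g i') else t0.
have Pg i : P i (g i) by elim: i => [//|i IHi]; have [] := Hf _ _ IHi.
pose p := mkseq (fun i => (g i).1) n.+1.
have pE i : (i <= n)%N -> nth (finset.set0, finset.set0) p i = (g i).1.
  by move=> ni; rewrite nth_mkseq.
pose N := \sum_(i < n.+1) (mx_sum_norm (differential x i) + mx_sum_norm (g i).2).
have nN i : (i <= n)%N -> mx_sum_norm (differential x i) + mx_sum_norm (g i).2 <= N.
  rewrite -ltnS => ni; rewrite /N (bigD1 (Ordinal ni))//= lerDl.
  by apply: sumr_ge0 => j _; rewrite addr_ge0 ?mx_sum_norm_ge0.
have NK : N <= (Num.truncn N).+1%:R by rewrite ltW// truncnS_gt.
exists p, (Num.truncn N).+1; split.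
- split => //; exists (fun i => (g i).2) => i ni.
  rewrite /pivot_rows /pivot_cols pE//; have [pv _ _] := Pg i; split => //.
    by rewrite (le_trans _ NK)// (le_trans _ (nN i ni))// lerDl mx_sum_norm_ge0.
  by rewrite (le_trans _ NK)// (le_trans _ (nN i ni))// lerDr mx_sum_norm_ge0.
- move=> i ni; rewrite /pivot_rows /pivot_cols (pE _ ni) (pE _ (ltnW ni)).
  by have [] := Hf _ _ (Pg i).
- by move=> i ni; rewrite /pivot_rows /pivot_cols pE//; have [_] := Pg i.
Qed.

Lemma card_free_coords p : pivots_compatible p ->
  (forall i, (i <= n)%N -> #|I_ p i| = #|J_ p i|) ->
  #|free_coords p| = (\sum_(i < n) (#|J_ p i.+1| * (m - #|J_ p i.+1|) +
     (m - #|J_ p i|) * #|J_ p i.+1|))%N.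
Proof.
move=> comp cIJ; rewrite -sum1_card big_mkcond/=.
transitivity (\sum_(i < n) \sum_(a < m) \sum_(b < m)
    if (i, a, b) \in free_coords p then 1 else 0)%N.
  by rewrite pair_bigA pair_bigA; apply: eq_bigr => -[[]].
apply: eq_bigr => i _.
set I := I_ p i.+1; set J := J_ p i.+1; set J' := J_ p i.
have cI : #|I| = #|J| by rewrite cIJ.
have IJ' : I \subset ~: J' by exact: comp.
(* The count goes by rows: a pivot row contributes all m entries, another row outside [J'] only its
   [#|J|] pivot columns, and a row in [J'] nothing. *)
have -> : (#|J| * (m - #|J|) + (m - #|J'|) * #|J| =
    \sum_(a < m) ((a \in I) * (m - #|J|) + (a \notin J') * #|J|))%N.
  rewrite big_split/= -!big_distrl/= -cI; congr (_ * _ + _ * _)%N.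
    by rewrite -sum1_card big_mkcond; apply: eq_bigr => a _; case: (_ \in _).
  have -> : (m - #|J'|)%N = #|~: J'|.
    by rewrite [RHS]finset.cardsCs finset.setCK card_ord.
  rewrite -sum1_card big_mkcond.
  by apply: eq_bigr => a _; rewrite inE; case: (_ \in _).
apply: eq_bigr => a _.
rewrite (eq_bigr (fun b => (a \notin J') && ((a \in I) || (b \in J)) : nat)); last first.
  by move=> b _; rewrite inE /=; case: (_ && _).
have cJm : (#|J| <= m)%N by rewrite -[leqRHS](card_ord m) max_card.
have [aJ|aJ] /= := boolP (a \in J').
  rewrite big1// (_ : a \in I = false) ?mul0n//.
  by apply/negP => /(fintype.subsetP IJ'); rewrite inE aJ.
have [aI|aI] /= := boolP (a \in I).
  by rewrite sum_nat_const card_ord muln1 !mul1n subnK.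
rewrite mul0n mul1n add0n -sum1_card [RHS]big_mkcond.
by apply: eq_bigr => b _; case: (_ \in _).
Qed.

End Pieces.

(* Twice the codimension of a rank stratum is the sum of the squares of the
   Betti numbers, because the terms 2 m (r_{i+1} - r_i) + r_i^2 - r_{i+1}^2
   telescope. *)
Lemma sum_rank_betti (m n : nat) (r : nat -> nat) : r 0%N = 0%N -> r n.+1 = 0%N ->
  (2 * \sum_(i < n) ((r i.+1)%:Z * (m%:Z - (r i.+1)%:Z) +
                     (m%:Z - (r i)%:Z) * (r i.+1)%:Z) +
   \sum_(i < n.+1) (m%:Z - (r i)%:Z - (r i.+1)%:Z) ^+ 2 = n.+1%:Z * m%:Z ^+ 2)%R.
Proof.
move=> r0 rn.
(* For partial sums the boundary terms 2 m r_k - r_k^2 remain; the last square (m - r_n)^2 cancels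
   them at k = n. *)
suff H k : 2 * \sum_(i < k) ((r i.+1)%:Z * (m%:Z - (r i.+1)%:Z) +
                     (m%:Z - (r i)%:Z) * (r i.+1)%:Z) +
   \sum_(i < k) (m%:Z - (r i)%:Z - (r i.+1)%:Z) ^+ 2 =
   k%:Z * m%:Z ^+ 2 + 2 * m%:Z * (r k)%:Z - (r k)%:Z ^+ 2.
  by rewrite [X in _ + X]big_ord_recr/= addrA H rn intS; ring.
elim: k => [|k IHk]; first by rewrite !big_ord0 r0; ring.
rewrite !big_ord_recr/= intS; move: IHk.
set A := \sum_(i < k) _; set B := \sum_(i < k) _ => IHk.
rewrite mulrDr addrACA IHk; ring.
Qed.

Lemma hmeasure_countable_cover_null (R : realType) (T : pointedType)
    (dist : T -> T -> R) (s : R) (Q : countType) (good : Q -> Prop)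
    (F : Q -> set T) (A : set T) :
  (forall q, good q -> hmeasure dist s (F q) = 0%E) ->
  (forall x, A x -> exists2 q, good q & F q x) ->
  hmeasure dist s A = 0%E.
Proof.
move=> F0 AF; apply/eqP; rewrite eq_le hmeasure_ge0 andbT.
pose G i := if (unpickle i : option Q) is Some q then
  (if `[< good q >] then F q else set0) else set0.
have AG : A `<=` \bigcup_i G i.
  by move=> x /AF[q gq Fq]; exists (pickle q) => //; rewrite /G pickleK asboolT.
apply: le_trans (le_hmeasure dist s AG) _.
apply: le_trans (hmeasure_sigma_subadditive dist s G) _.
rewrite eseries0// => i _ _; rewrite /G.
case: unpickle => [q|]; last exact: hmeasure0.
by case: asboolP => [/F0//|_]; exact: hmeasure0.
Qed.

(** * Comparison of the strata with the even-indexed coordinate subspace *)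

Section GenericStratum.
Context {R : realType} {n m : nat}.

(* Index i stands for d_(i+1). *)
Definition even_coords : {set cindex n m} :=
  [set c : cindex n m | ~~ odd c.1.1]%SET.

(** For odd n, exactly (n+1)/2 of the indices 0, ..., n-1 are even, and each carries m^2 entries. *)
Lemma card_even_coords : odd n -> (2 * #|even_coords| = n.+1 * (m * m))%N.
Proof.
move=> oddn; rewrite -sum1_card big_mkcond/=.
transitivity (2 * \sum_(i < n) \sum_(a < m) \sum_(b < m) ~~ odd i)%N.
  rewrite pair_bigA pair_bigA; congr (2 * _)%N; apply: eq_bigr => -[[i a] b] _.
  by rewrite inE /=; case: odd.
rewrite (eq_bigr (fun i : 'I_n => (~~ odd i) * (m * m))%N); last first.
  by move=> i _; rewrite !sum_nat_const !card_ord mulnA mulnC.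
have sum_even k : (\sum_(i < k) ~~ odd i = uphalf k)%N.
  by elim: k => [|k IHk]; rewrite ?big_ord0// big_ord_recr/= IHk uphalf_half; lia.
rewrite -big_distrl/= sum_even mulnA; congr (_ * _)%N.
by rewrite uphalf_half oddn; move: (odd_double_half n); rewrite oddn; lia.
Qed.

(** Of two consecutive maps one has odd index and vanishes, so every composite is zero. *)
Lemma even_coords_chain_complexes (x : cspace R n m) :
  (forall c, c \notin even_coords -> x c = 0) -> chain_complexes R n m x.
Proof.
move=> x0 i j ij.
have odd0 (l : 'I_n) : odd l -> cmap x l = 0.
  move=> ol; apply/matrixP => a b; rewrite !mxE; apply: x0.
  by rewrite inE /= negbK.
have [oi|ei] := boolP (odd i); first by rewrite (odd0 i)// mul0mx.
by rewrite (odd0 j) ?mulmx0// ij.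
Qed.

(** The exceptional complexes lie in countably many pieces, indexed by pivots and an integer bound,
    each with fewer free coordinates than [even_coords]. *)
Lemma chain_complexes_betti_null (k : R) : odd n ->
  #|even_coords|%:R <= k ->
  hmeasure (@euclid_dist (cindex n m) R) k
    (chain_complexes R n m `\`
     [set x | chain_complexes R n m x /\
              forall i : nat, (i <= n)%N -> betti x i = 0]) = 0%E.
Proof.
move=> oddn dk.
apply: (@hmeasure_countable_cover_null _ _ _ _
  (seq ({set 'I_m} * {set 'I_m}) * nat)%type
  (fun q => pivots_compatible (n := n) q.1 /\
            (#|free_coords (n := n) q.1| < #|even_coords|)%N)
  (fun q => chain_piece q.1 q.2)).
  move=> [p K] /= [comp lt]; apply: chain_piece_null => //.
  by apply: le_trans dk; rewrite ler_nat.
move=> x [Mx nYx]; have [p [K [xp comp cardp]]] := chain_piece_exists x Mx.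
exists (p, K) => //=; split => //.
have [i ni bi] : exists2 i, (i <= n)%N & betti x i != 0.
  apply: contrapT => nex; apply: nYx; split => // i ni; apply/eqP/negPn/negP => bi.
  by apply: nex; exists i.
have rm j : (crank x j <= m)%N by rewrite crankE rank_leq_row.
have := sum_rank_betti m n (crank x) erefl.
have rn : crank x n.+1 = 0%N by rewrite /= insubF ?ltnn.
move=> /(_ rn).
have -> : \sum_(j < n) ((crank x j.+1)%:Z * (m%:Z - (crank x j.+1)%:Z) +
    (m%:Z - (crank x j)%:Z) * (crank x j.+1)%:Z) = #|free_coords (n := n) p|%:Z.
  rewrite card_free_coords//; last by move=> j /cardp[-> ->].
  rewrite (big_morph Posz PoszD (erefl : 0%N%:Z = 0)).
  apply: eq_bigr => j _; have [_ ->] := cardp _ (ltn_ord j).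
  have [_ ->] := cardp _ (ltnW (ltn_ord j)).
  by rewrite PoszD !PoszM !subzn.
rewrite (bigD1 (Ordinal (ni : (i < n.+1)%N)))//= -/(betti x i).
have rest : 0 <= \sum_(j < n.+1 | j != Ordinal (ni : (i < n.+1)%N))
    (m%:Z - (crank x j)%:Z - (crank x j.+1)%:Z) ^+ 2.
  by apply: sumr_ge0 => j _; rewrite sqr_ge0.
(* A non-zero integer has square at least 1. This makes the comparison of cardinalities strict,
   which is the gap of one that [chain_piece_null] requires. *)
have bi1 : 1 <= betti x i ^+ 2 by rewrite -gtz0_ge1 exprn_even_gt0.
move: (card_even_coords oddn) rest bi1.
move: (\sum_(j < n.+1 | _) _) (betti x i ^+ 2) => u v.
move=> cE u0 v1 E.
have {}cE : 2 * #|even_coords|%:Z = n.+1%:Z * m%:Z ^+ 2.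
  by rewrite expr2 -!PoszM cE.
rewrite -cE in E; rewrite -ltz_nat; lra.
Qed.

End GenericStratum.

Theorem theorem4p1 (R : realType) (n m : nat) (k : R)
    (f : cspace R n m -> R) :
  odd n -> (0 < m)%N ->
  (* k is the Hausdorff dimension of M *)
  hdim (@euclid_dist (cindex n m) R) (chain_complexes R n m) = k%:E ->
  (* f is a bounded (Borel) measurable probability density on R^N *)
  @borel_fun (cindex n m) R f -> (forall x, 0 <= f x) -> (exists B : R, forall x, f x <= B) ->
  @lebesgue_integral (cindex n m) R f = 1%:E ->
  (* \int_M f dH^k is positive (and finite, so that Pr is defined) *)
  (0 < @hausdorff_integral (cindex n m) R k (chain_complexes R n m) f)%E ->
  (@hausdorff_integral (cindex n m) R k (chain_complexes R n m) f < +oo)%E ->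
  (* almost surely all Betti numbers vanish *)
  chain_prob k f [set x | chain_complexes R n m x /\
                          forall i : nat, (i <= n)%N -> betti x i = 0] = 1.
Proof.
move=> oddn _ dimM _ f0 _ _ int_gt0 int_lty; rewrite /chain_prob.
have dk : #|@even_coords n m|%:R <= k.
  rewrite -lee_fin -dimM; apply: hdim_coord_subspace_ge => x.
  exact: even_coords_chain_complexes.
rewrite (hausdorff_integral_negligible _ _ k (chain_complexes R n m))//; last first.
- exact: chain_complexes_betti_null.
- by move=> x [].
(* Numerator and denominator now coincide; positivity and finiteness of the integral make its [fine]
   value non-zero. *)
by rewrite mulfV// gt_eqF// fine_gt0// int_gt0 int_lty.
Qed.
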